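(* Let $\Delta$ be a finite simplicial complex with set of $q$-simplices $S_q=\{\sigma_1^{(q)},\dots,\sigma_{n_q}^{(q)}\}$ for each $q$, let $a:S_0\to\mathbb{Q}^+$ be a weight map on the $0$-simplices, let $a_q:S_{q-1}\times S_q\to\mathbb{Q}_{\ge 0}$ be a fractional weight contribution map for each $1\le q\le\dim(\Delta)$, and let $a:\Delta\to\mathbb{Q}_{\ge 0}$ be the induced weight map on all simplices. Then the total weight of all facets of $\Delta$ equals the total weight of the $0$-simplices: \[ \sum_{\sigma\text{ is a facet of }\Delta} a(\sigma)=\sum_{i=1}^{n_0}a(\sigma_i^{(0)}). \]
   Context: Let $V$ be a finite non-empty set. A simplex over $V$ is a non-empty subset $\sigma\subseteq V$, of dimension $\dim(\sigma)=|\sigma|-1$; a $q$-simplex is a simplex of dimension $q$, often written $\sigma^{(q)}$. A (finite, abstract) simplicial complex $\Delta$ over $V$ is a collection of simplices such that every non-empty subset of a member of $\Delta$ is in $\Delta$. $\dim(\Delta)$ is the largest dimension of a simplex in $\Delta$. $S_q$ is the set of $q$-simplices of $\Delta$, and $n_q=|S_q|$. A facet of $\Delta$ is a simplex of $\Delta$ not contained in any other simplex of $\Delta$. For a simplex $\sigma^{(q-1)}\in S_{q-1}$, $k_{\sigma^{(q-1)}}$ denotes the number of $q$-simplices of $\Delta$ that strictly contain it. Fractional weight contribution map. For $1\le q\le\dim(\Delta)$, a fractional weight contribution map is a map $a_q:S_{q-1}\times S_q\to\mathbb{Q}_{\ge 0}$ such that: (i) $a_q(\sigma^{(q-1)},\sigma^{(q)})=0$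 if $\sigma^{(q-1)}\not\subset\sigma^{(q)}$; (ii) $0<a_q(\sigma^{(q-1)},\sigma^{(q)})\le 1$ if $\sigma^{(q-1)}\subset\sigma^{(q)}$; (iii) $\sum_{\sigma^{(q)}\in S_q}a_q(\sigma^{(q-1)},\sigma^{(q)})=1$ for each $\sigma^{(q-1)}\in S_{q-1}$ with $k_{\sigma^{(q-1)}}\neq 0$. Induced weight map. Given $a:S_0\to\mathbb{Q}^+$ (strictly positive rational weights) and maps $a_q$ for all $1\le q\le\dim(\Delta)$, the weight map is extended inductively to all simplices of $\Delta$ by \[ a(\sigma^{(q)})=\sum_{\sigma^{(q-1)}\in S_{q-1}}a_q(\sigma^{(q-1)},\sigma^{(q)})\,a(\sigma^{(q-1)}),\qquad \sigma^{(q)}\in S_q,\ q\ge 1. \] *)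

(* Defs.v *)
From mathcomp Require Import all_boot all_order all_algebra.

Set Implicit Arguments.
Unset Strict Implicit.
Unset Printing Implicit Defensive.

Import Order.TTheory GRing.Theory Num.Theory.

Definition simplicial_complex (V : finType) (D : {set {set V}}) : Prop :=
  set0 \notin D /\
  forall s t : {set V}, s \in D -> t != set0 -> t \subset s -> t \in D.

(* The truncated predecessor gives [set0] dimension 0, but [set0] never
   belongs to a simplicial complex. *)
Definition sdim (V : finType) (s : {set V}) : nat := #|s|.-1.

Definition cdim (V : finType) (D : {set {set V}}) : nat :=
  \max_(s in D) sdim s.

Definition simplices (V : finType) (D : {set {set V}}) (q : nat) :
  {set {set V}} := [set s in D | sdim s == q].

Definition facets (V : finType) (D : {set {set V}}) : {set {set V}} :=
  [set s in D | [forall t in D, ~~ (s \proper t)]].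

Definition num_cofaces (V : finType) (D : {set {set V}}) (s : {set V}) : nat :=
  #|[set t in simplices D (sdim s).+1 | s \proper t]|.

Local Open Scope ring_scope.

(* Weight maps are total functions on [{set V}]; only their values on simplices
   of [D] of the relevant dimensions are constrained or ever used. *)

(* [f] is a fractional weight contribution map S_(q-1) x S_q -> Q_(>= 0);
   meaningful for [0 < q]. *)
Record frac_weight_contribution (V : finType) (D : {set {set V}}) (q : nat)
    (f : {set V} -> {set V} -> rat) : Prop := FracWeightContribution {
  fwc_ge0 : forall s t, s \in simplices D q.-1 -> t \in simplices D q ->
    0 <= f s t;
  fwc_notsub : forall s t, s \in simplices D q.-1 -> t \in simplices D q ->
    ~~ (s \subset t) -> f s t = 0;
  fwc_sub : forall s t, s \in simplices D q.-1 -> t \in simplices D q ->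
    s \subset t -> 0 < f s t <= 1;
  fwc_sum : forall s, s \in simplices D q.-1 -> num_cofaces D s <> 0%N ->
    \sum_(t in simplices D q) f s t = 1
}.

(* The induced weight on q-simplices, by recursion on q; [f q] plays a_q. *)
Fixpoint weight_rec (V : finType) (D : {set {set V}}) (a0 : {set V} -> rat)
    (f : nat -> {set V} -> {set V} -> rat) (q : nat) (t : {set V}) : rat :=
  if q is p.+1 then
    \sum_(s in simplices D p) f q s t * weight_rec D a0 f p s
  else a0 t.

Definition weight (V : finType) (D : {set {set V}}) (a0 : {set V} -> rat)
    (f : nat -> {set V} -> {set V} -> rat) (t : {set V}) : rat :=
  weight_rec D a0 f (sdim t) t.

(* Main.v *)
Require Import Defs.
From mathcomp Require Import all_boot all_order all_algebra.
Import Order.TTheory GRing.Theory Num.Theory.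
Local Open Scope ring_scope.

(** The weight of a [q]-simplex with a coface is passed on in full to the
    [(q+1)]-simplices, while that of a [q]-facet is lost.  So the total weight
    [W_q] in dimension [q] satisfies [W_q = F_q + W_(q+1)] with [F_q] the weight
    of the [q]-facets, and the sum telescopes since [W_q = 0] above the
    dimension of the complex. *)

Lemma sdim_le_cdim {V : finType} {D : {set {set V}}} {s : {set V}} :
  s \in D -> (sdim s <= cdim D)%N.
Proof. by move=> sD; rewrite /cdim; exact: leq_bigmax_cond. Qed.

Lemma simplices_gt_cdim {V : finType} {D : {set {set V}}} (q : nat) :
  (cdim D < q)%N -> simplices D q = set0.
Proof.
move=> ltq; apply/setP => s; rewrite !inE; apply/negbTE/negP.
by case/andP=> /sdim_le_cdim + /eqP sq; rewrite sq leqNgt ltq.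
Qed.

(** A simplex [t] properly containing [s] may be of much higher dimension, but [s] with one vertex
    of [t] outside [s] is a face of [t], hence in [D]. *)
Lemma non_facet_coface {V : finType} {D : {set {set V}}} {s : {set V}} :
  simplicial_complex D -> s \in D -> s \notin facets D ->
  exists2 t, t \in simplices D (sdim s).+1 & s \proper t.
Proof.
move=> [D0 Dsub] sD; rewrite inE sD /= => /forall_inPn[t tD].
rewrite negbK => /properP[st [x xt xs]].
(* Since [sdim] truncates at 0, adding a vertex raises it by one only when [s] is non-empty. *)
have s_gt0 : (0 < #|s|)%N.
  by rewrite card_gt0; apply: contra D0 => /eqP <-.
exists (x |: s); last first.
  by apply/properP; split; [exact: subsetU1 | exists x; rewrite ?setU11].
rewrite inE (Dsub t) //=; last 2 first.
- by apply/set0Pn; exists x; rewrite setU11.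
- by rewrite subUset sub1set xt.
by rewrite /sdim cardsU1 xs add1n /= prednK.
Qed.

Section WeightFlow.
Variables (V : finType) (D : {set {set V}}).
Hypothesis D_complex : simplicial_complex D.
Variables (a0 : {set V} -> rat) (f : nat -> {set V} -> {set V} -> rat).
Hypothesis f_frac : forall q : nat, (1 <= q <= cdim D)%N ->
  frac_weight_contribution D q (f q).

(** A non-facet has a coface, so [fwc_sum] applies; for a facet every term vanishes by
    [fwc_notsub]. *)
Lemma sum_contributions (q : nat) (s : {set V}) : s \in simplices D q ->
  \sum_(t in simplices D q.+1) f q.+1 s t = (s \notin facets D)%:R.
Proof.
move=> sq; have := sq; rewrite inE => /andP[sD /eqP dims].
(* The bound [q.+1 <= cdim D] required by [f_frac] is witnessed by any simplex [t] of dimension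
   [q.+1]. *)
have frac t : t \in simplices D q.+1 ->
    frac_weight_contribution D q.+1 (f q.+1).
  rewrite inE => /andP[/sdim_le_cdim + /eqP dimt]; rewrite dimt => le.
  exact: f_frac.
have [sF | sNF] := boolP (s \in facets D).
  apply: big1 => t tq; apply: (fwc_notsub (frac t tq)) => //.
  move: sF tq; rewrite !inE => /andP[_ /forall_inP maxs] /andP[tD /eqP dimt].
  apply: contra (maxs t tD) => st; rewrite properEneq st andbT.
  by apply/eqP=> eqst; move: dimt; rewrite -eqst dims => /n_Sn.
have [t tq st] := non_facet_coface D_complex sD sNF.
rewrite (fwc_sum (frac t _)) //; first by rewrite -dims.
apply/eqP; rewrite -lt0n; apply/card_gt0P.
by exists t; rewrite inE tq st.
Qed.

Lemma weight_simplices_step (q : nat) :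
  \sum_(s in simplices D q) weight_rec D a0 f q s =
  \sum_(s in facets D | sdim s == q) weight D a0 f s
  + \sum_(t in simplices D q.+1) weight_rec D a0 f q.+1 t.
Proof.
(* Summing over [t] first collects all that each [s] passes upwards. *)
rewrite /= exchange_big /=.
rewrite [X in _ + X](eq_bigr
    (fun s => if s \notin facets D then weight_rec D a0 f q s else 0)).
  rewrite -big_mkcondr (bigID (mem (facets D))) /=; congr (_ + _).
  apply: eq_big => s.
    by rewrite !inE; case: (s \in D); rewrite //= andbC.
  by rewrite inE /weight => /andP[/andP[_ /eqP ->]].
move=> s sq; rewrite -mulr_suml sum_contributions //.
by case: ifP; rewrite ?mul1r ?mul0r.
Qed.

Lemma weight_vertices_telescope (n : nat) :
  \sum_(s in simplices D 0) weight_rec D a0 f 0 s =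
  \sum_(s in facets D | (sdim s < n)%N) weight D a0 f s
  + \sum_(t in simplices D n) weight_rec D a0 f n t.
Proof.
elim: n => [|n ->].
  by rewrite [X in _ = X + _]big_pred0 ?add0r // => s; rewrite ltn0 andbF.
rewrite weight_simplices_step addrA; congr (_ + _).
(* Facets of dimension below [n.+1] split into those below [n] and those of dimension exactly
   [n]. *)
rewrite [RHS](bigID (fun s => (sdim s < n)%N)) /=.
congr (_ + _); apply: eq_bigl => s; rewrite -andbA; congr (_ && _).
  by rewrite ltnS andb_idl // => /ltnW.
by rewrite ltnS -leqNgt -eqn_leq.
Qed.

End WeightFlow.

Theorem theorem3p5 (V : finType) (V_nonempty : (0 < #|V|)%N)
    (D : {set {set V}}) (D_complex : simplicial_complex D)
    (a0 : {set V} -> rat)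
    (a0_gt0 : forall s : {set V}, s \in simplices D 0 -> 0 < a0 s)
    (f : nat -> {set V} -> {set V} -> rat)
    (f_frac : forall q : nat, (1 <= q <= cdim D)%N ->
       frac_weight_contribution D q (f q)) :
  \sum_(s in facets D) weight D a0 f s =
  \sum_(s in simplices D 0) weight D a0 f s.
Proof.
rewrite [RHS](eq_bigr (weight_rec D a0 f 0)); last first.
  by move=> s; rewrite inE /weight => /andP[_ /eqP ->].
(* One step past the top dimension, the remainder is an empty sum and the bound on [sdim] holds for
   every facet. *)
rewrite (weight_vertices_telescope _ _ D_complex a0 _ f_frac (cdim D).+1).
rewrite simplices_gt_cdim // big_set0 addr0; apply: eq_bigl => s.
rewrite andb_idr // inE => /andP[sD _].
by rewrite ltnS sdim_le_cdim.
Qed.
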